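(* Suppose that $r_N(\hat\theta_N-\theta_0)\stackrel{d}{\to}G$ as $N\to\infty$, where $G$ has mean zero and variance $\sigma^2>0$. Fix an integer $m\ge 1$, let $N=m\times n$, and let $\bar\theta=\frac1m\sum_{j=1}^m\hat\theta_j$ be the pooled estimator, where $\hat\theta_j$ is the estimator computed from the $j$-th of $m$ disjoint subsamples of size $n$. Then, as $n\to\infty$, $$\sqrt m\, r_n(\bar\theta-\theta_0)\stackrel{d}{\to}H:=m^{-1/2}(G_1+G_2+\cdots+G_m),$$ where $G_1,\dots,G_m$ are i.i.d. with the same distribution as $G$. The limiting random variable $H$ has mean zero and variance $\sigma^2$.
   Context: $W_1,W_2,\dots$ are i.i.d. random elements with common distribution $P$, and $\theta_0=\theta_0(P)\in\mathbb R$ is a parameter of interest. For each sample size $N$, $\hat\theta_N$ is a real-valued estimator of $\theta_0$ (a measurable function of a sample of size $N$), and $(r_N)$ is a sequence of positive numbers with $r_N=o(\sqrt N)$; the limit $G$ is non-normal. With $N=m\times n$, the sample $W_1,\dots,W_N$ is divided into $m$ disjoint subsets $S_1,\dots,S_m$ each of size $n$, and $\hat\theta_j$ is the estimator $\hat\theta_n$ applied to the data in $S_j$. *)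

(* Defs.v *)
From HB Require Import structures.
From mathcomp Require Import all_boot all_order all_algebra finmap.
From mathcomp Require Import all_classical all_reals all_analysis.

Set Implicit Arguments.
Unset Strict Implicit.
Unset Printing Implicit Defensive.

Import Order.TTheory GRing.Theory Num.Theory.
Import numFieldNormedType.Exports.

Local Open Scope classical_set_scope.
Local Open Scope ring_scope.

(* Equality of measures is only required on measurable sets: the values of a
   [distribution] or of [normal_prob] elsewhere carry no meaning. *)
Definition same_law d (T : measurableType d) (R : realType)
    (mu nu : set T -> \bar R) : Prop :=
  forall A : set T, measurable A -> mu A = nu A.

(* The case s = 0 is excluded because [normal_prob a 0] is by convention the
   uniform law on [0, 1], and not a (degenerate) normal law. *)
Definition non_normal d (Omega : measurableType d) (R : realType)
    (P : probability Omega R) (X : {RV P >-> R}) : Prop :=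
  forall a s : R, s != 0 -> ~ same_law (distribution P X) (normal_prob a s).

(* Mutual independence: product rule over every finite subfamily. *)
Definition mutually_independent d (Omega : measurableType d) (R : realType)
    (P : probability Omega R) d' (T : measurableType d') (I : choiceType)
    (X : I -> {RV P >-> T}) : Prop :=
  forall (J : {fset I}) (B : I -> set T),
    (forall i, measurable (B i)) ->
    P (\bigcap_(i in [set` J]) (X i @^-1` B i)) =
    (\prod_(i <- J) P (X i @^-1` B i))%E.

Definition iid d (Omega : measurableType d) (R : realType)
    (P : probability Omega R) d' (T : measurableType d') (I : choiceType)
    (X : I -> {RV P >-> T}) (mu : set T -> \bar R) : Prop :=
  mutually_independent X /\ forall i, same_law (distribution P (X i)) mu.

(* The X n and the limit Y may live on different probability spaces. *)
Definition cvg_in_distribution (R : realType)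
    d (Omega : measurableType d) (P : probability Omega R) (X : nat -> Omega -> R)
    d' (Omega' : measurableType d') (Q : probability Omega' R) (Y : Omega' -> R)
    : Prop :=
  forall f : R -> R, continuous f -> bounded_fun f ->
    ('E_P[f \o X n])%E @[n --> \oo] --> ('E_Q[f \o Y])%E.

Section estimators.
Context d (Omega : measurableType d) (R : realType)
  d' (T : measurableType d') (W : nat -> Omega -> T)
  (est : forall N, {mfun N.-tuple T >-> R}).

Definition full_estimator (N : nat) (w : Omega) : R :=
  est N [tuple W i w | i < N].

(* A subset of size n of the sample of size N, given by listing its indices. *)
Definition sub_estimator (N n : nat) (S : n.-tuple 'I_N) (w : Omega) : R :=
  est n [tuple W (tnth S i) w | i < n].

Definition pooled_estimator (m n : nat) (S : 'I_m -> n.-tuple 'I_(m * n))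
    (w : Omega) : R :=
  m%:R^-1 * \sum_(j < m) sub_estimator (S j) w.

End estimators.

(* m subsets of size n of m * n indices; disjointness makes them a partition. *)
Definition equal_split (m n : nat) (S : 'I_m -> n.-tuple 'I_(m * n)) : Prop :=
  (forall j, uniq (S j)) /\
  (forall (j k : 'I_m) (i : 'I_(m * n)), i \in S j -> i \in S k -> j = k).

(* Main.v *)
Require Import Defs.
From HB Require Import structures.
From mathcomp Require Import all_boot all_order all_algebra finmap.
From mathcomp Require Import all_classical all_reals all_analysis.
From mathcomp Require Import measurable_realfun ring lra.

(* For fixed n the block estimators are functions of disjoint blocks of an
   i.i.d. sequence: they are independent, and each has the law of the full
   estimator at sample size n. It remains to pass to the limit in sums of
   independent variables: on a compact square f(y + z) is uniformly close to a
   finite sum of products phi_i(y) psi_i(z) of bounded continuous functions,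
   whose expectations factor by independence and hence converge, while
   tightness controls the complement of the square. *)

Set Implicit Arguments.
Unset Strict Implicit.
Unset Printing Implicit Defensive.

Import Order.TTheory GRing.Theory Num.Theory.
Import numFieldNormedType.Exports.

Local Open Scope classical_set_scope.
Local Open Scope ring_scope.

(** Convergence in distribution is tested on functions of one real variable, and [f (y + z)] does
    not factor; splitting it into products is what makes the marginal convergences usable. Tightness
    is invoked for the two limit variables only. The cutoff [chi] is itself a bounded continuous
    function, so the expectation of [chi (X n)] converges to that of [chi (Y)], and the bound on the
    mass lost by the cutoff passes from the limit to the sequence. This is why the error estimates
    are phrased with expectations of [chi] and not with tail probabilities. A sum of m terms is
    treated by induction, separating one term from the sum of the others. The variance of the limit
    uses the same separation: the covariance of the two parts vanishes. *)

(** * Independence of two variables, and extension from pi-systems *)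

Definition indep2 d (Omega : measurableType d) (R : realType)
    (P : probability Omega R) d1 (T1 : measurableType d1) d2
    (T2 : measurableType d2) (X : Omega -> T1) (Y : Omega -> T2) : Prop :=
  forall A B, measurable A -> measurable B ->
    P (X @^-1` A `&` Y @^-1` B) = (P (X @^-1` A) * P (Y @^-1` B))%E.

Lemma indep2_comp d (Omega : measurableType d) (R : realType)
    (P : probability Omega R) d1 (T1 : measurableType d1) d2
    (T2 : measurableType d2) d3 (U1 : measurableType d3) d4
    (U2 : measurableType d4) (X : Omega -> T1) (Y : Omega -> T2)
    (f : T1 -> U1) (g : T2 -> U2) :
  measurable_fun setT f -> measurable_fun setT g ->
  indep2 P X Y -> indep2 P (f \o X) (g \o Y).
Proof.
move=> mf mg XY A B mA mB; apply: (XY (f @^-1` A) (g @^-1` B)).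
  by rewrite -[_ @^-1` _]setTI; exact: mf.
by rewrite -[_ @^-1` _]setTI; exact: mg.
Qed.

Section pi_lambda.
Context d (Omega : measurableType d) (R : realType) (P : probability Omega R).
Context d1 (U : measurableType d1).

(** Uniqueness of finite measures on a pi-system; [G setT] lets the constant sequence [setT] serve
    as the exhaustion by sets of finite measure. *)
Lemma law_ext d' (Omega' : measurableType d') (Q : probability Omega' R)
    (V : {RV P >-> U}) (V' : {RV Q >-> U}) (G : set (set U)) :
  measurable = <<s G >> -> setI_closed G -> G setT ->
  (forall A, G A -> P (V @^-1` A) = Q (V' @^-1` A)) ->
  forall A, measurable A -> P (V @^-1` A) = Q (V' @^-1` A).
Proof.
move=> mG GI GT VV' A mA.
apply: (measure_unique G (fun=> setT) mG GI _ _
  (distribution P V) (distribution Q V')) => //.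
- by rewrite bigcup_const.
- by move=> _ /=; rewrite probability_setT ltry.
Qed.

(** As functions of [A], both sides are finite measures: the restriction of [P] to [F] pushed
    forward by [V], and the law of [V] scaled by [P F]. Freezing one event allows independence of
    two variables to be extended one variable at a time. *)
Lemma indep_event_ext (V : {RV P >-> U}) (G : set (set U)) (F : set Omega) :
  measurable = <<s G >> -> setI_closed G -> G setT -> measurable F ->
  (forall A, G A -> P (V @^-1` A `&` F) = (P (V @^-1` A) * P F)%E) ->
  forall A, measurable A -> P (V @^-1` A `&` F) = (P (V @^-1` A) * P F)%E.
Proof.
move=> mG GI GT mF VF A mA.
have pF : 0 <= fine (P F) by rewrite fine_ge0.
pose m1 : {measure set U -> \bar R} :=
  measure_function_pushforward__canonical__measure_function_Measure
    (mrestr P mF) (@measurable_funPT _ _ _ _ V).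
pose m2 : {measure set U -> \bar R} := mscale (NngNum pF) (distribution P V).
have m2E B : m2 B = (P (V @^-1` B) * P F)%E.
  by rewrite /m2/= /mscale/= fineK ?fin_num_measure// muleC.
rewrite -m2E; apply: (measure_unique G (fun=> setT) mG GI _ _ m1 m2) => //.
- by rewrite bigcup_const.
- by move=> B GB; rewrite m2E; exact: VF.
- by move=> _; rewrite /m1/= /pushforward /mrestr preimage_setT setTI
    -ge0_fin_numE// fin_num_measure.
Qed.

End pi_lambda.

(** * Measurable rectangles, and blocks of an independent family *)

Section rectangles.
Context d (T : measurableType d) (n : nat).

Definition rect (B : 'I_n -> set T) : set (n.-tuple T) :=
  [set t | forall i, B i (tnth t i)].

Definition rects : set (set (n.-tuple T)) :=
  [set rect B | B in [set B | forall i, measurable (B i)]].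

Lemma rects_setI : setI_closed rects.
Proof.
move=> _ _ [B mB <-] [C mC <-]; exists (fun i => B i `&` C i).
  by move=> i; exact: measurableI.
apply/seteqP; split=> t /=; first by move=> BC; split=> i; case: (BC i).
by move=> [Bt Ct] i; split; [exact: Bt|exact: Ct].
Qed.

Lemma rects_setT : rects setT.
Proof.
exists (fun=> setT) => [i|]; first exact: measurableT.
by apply/seteqP; split.
Qed.

(** A coordinate preimage is a rectangle whose other sides are full, and a rectangle is a finite
    intersection of coordinate preimages. *)
Lemma measurable_rects : @measurable _ (n.-tuple T) = <<s rects >>.
Proof.
apply/seteqP; split.
  apply: smallest_sub; first exact: smallest_sigma_algebra.
  rewrite -bigcup_seq => A [/= i _ [B mB <-]]; apply: sub_sigma_algebra.
  exists (fun j => if j == i then B else setT).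
    by move=> j; case: ifP.
  apply/seteqP; split=> t /=.
    by move=> /(_ i); rewrite eqxx.
  by move=> [_ Bt] j; case: eqP => // ->.
apply: smallest_sub; first exact: sigma_algebra_measurable.
move=> _ [B mB <-].
rewrite (_ : rect B = \bigcap_(i in [set: 'I_n]) (@tnth n T ^~ i) @^-1` B i).
  apply: fin_bigcap_measurable => // i _.
  by rewrite -[_ @^-1` _]setTI; exact: measurable_tnth.
by apply/seteqP; split=> t /= Bt i; [move=> _; exact: Bt|exact: Bt].
Qed.

End rectangles.

Section tuple_of_variables.
Context d (Omega : measurableType d) (R : realType) (P : probability Omega R).
Context d1 (T : measurableType d1) (I : choiceType) (X : I -> {RV P >-> T}).

Definition rvtuple n (s : n.-tuple I) (w : Omega) : n.-tuple T :=
  [tuple X (tnth s i) w | i < n].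

Lemma measurable_rvtuple n (s : n.-tuple I) : measurable_fun setT (rvtuple s).
Proof.
apply/measurable_fun_tnthP => i.
rewrite (_ : _ \o _ = X (tnth s i)) //.
by apply/funext => w /=; rewrite tnth_mktuple.
Qed.

HB.instance Definition _ n (s : n.-tuple I) :=
  isMeasurableFun.Build _ _ _ _ (rvtuple s) (measurable_rvtuple s).

Lemma preimage_rvtuple n (s : n.-tuple I) (B : 'I_n -> set T) :
  rvtuple s @^-1` rect B = [set w | forall i, B i (X (tnth s i) w)].
Proof.
by apply/seteqP; split=> w /= Bw i; have := Bw i; rewrite tnth_mktuple.
Qed.

Lemma mutually_independent_rect : mutually_independent X ->
  forall n (s : n.-tuple I) (B : 'I_n -> set T), uniq s ->
  (forall i, measurable (B i)) ->
  P (rvtuple s @^-1` rect B) = (\prod_(i < n) P (X (tnth s i) @^-1` B i))%E.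
Proof.
move=> indX n s B us mB; rewrite preimage_rvtuple.
(* Mutual independence indexes its sets by elements of [I], a rectangle by positions in [s]. Since
   [s] has no repetition, [C] can attach to [x] the side at its position; the default [setT] keeps
   [C x] measurable elsewhere. *)
pose C x := nth setT (mktuple B) (index x s).
have CE i : C (tnth s i) = B i.
  rewrite /C (tnth_nth (tnth s i)) index_uniq ?size_tuple//.
  by rewrite -tnth_nth tnth_mktuple.
have mC x : measurable (C x).
  rewrite /C; have [xs|xs] := ltnP (index x s) n.
    by rewrite -(tnth_nth _ _ (Ordinal xs)) tnth_mktuple.
  by rewrite nth_default// size_tuple.
have := indX [fset x in val s]%fset C mC.
rewrite (_ : \bigcap_(i in _) _ = [set w | forall i, B i (X (tnth s i) w)]).
  move=> ->; rewrite (perm_big (val s)) /=; last first.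
    by apply: uniq_perm => // x; rewrite !inE.
  by rewrite big_tuple; apply: eq_bigr => i _; rewrite CE.
apply/seteqP; split=> w /= Cw.
  by move=> i; rewrite -CE; apply: Cw; rewrite /= !inE mem_tnth.
by move=> x /=; rewrite !inE => /tnthP[i ->]; rewrite /preimage/= CE.
Qed.

(** When both events are rectangles, their intersection is one rectangle event of the concatenated
    tuple, to which the product rule applies. Two extensions, one per tuple, reach all measurable
    sets. *)
Lemma rvtuple_indep2 : mutually_independent X ->
  forall n m (s : n.-tuple I) (t : m.-tuple I), uniq (s ++ t) ->
  indep2 P (rvtuple s) (rvtuple t).
Proof.
move=> indX n m s t ust.
have [us ut] : uniq s /\ uniq t by move: ust; rewrite cat_uniq => /and3P[].
have mt A : measurable A -> measurable (rvtuple t @^-1` A).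
  by move=> mA; rewrite -[_ @^-1` _]setTI; exact: measurable_rvtuple.
have ms A : measurable A -> measurable (rvtuple s @^-1` A).
  by move=> mA; rewrite -[_ @^-1` _]setTI; exact: measurable_rvtuple.
have mrect k (A : set (k.-tuple T)) : rects A -> measurable A.
  by rewrite measurable_rects; exact: sub_sigma_algebra.
move=> A B mA mB.
apply: (indep_event_ext (V := rvtuple s) (measurable_rects T n)) => //.
- exact: rects_setI.
- exact: rects_setT.
- exact: mt.
(* [A] is now a rectangle; exchanging the factors allows the same extension in [B]. *)
move=> {A mA}A rA; rewrite setIC muleC.
apply: (indep_event_ext (V := rvtuple t) (measurable_rects T m)) => //.
- exact: rects_setI.
- exact: rects_setT.
- by apply: ms; exact: mrect.
move=> {B mB}_ [C mC <-]; move: A rA => _ [B mB <-].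
rewrite !mutually_independent_rect//.
pose D (i : 'I_(n + m)) := match fintype.split i with inl j => B j | inr j => C j end.
have Dl j : D (lshift m j) = B j by rewrite /D (unsplitK (inl j)).
have Dr j : D (rshift n j) = C j by rewrite /D (unsplitK (inr j)).
have mD i : measurable (D i) by rewrite /D; case: fintype.split.
rewrite (_ : _ `&` _ = rvtuple (cat_tuple s t) @^-1` rect D).
  rewrite mutually_independent_rect// big_split_ord/= muleC; congr (_ * _)%E.
    by apply: eq_bigr => i _; rewrite tnth_rshift Dr.
  by apply: eq_bigr => i _; rewrite tnth_lshift Dl.
rewrite !preimage_rvtuple; apply/seteqP; split=> w /=.
  move=> [Cw Bw] i; rewrite -(splitK i); case: (fintype.split i) => j /=.
    by rewrite tnth_lshift Dl.
  by rewrite tnth_rshift Dr.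
move=> Dw; split=> j.
  by have := Dw (rshift n j); rewrite tnth_rshift Dr.
by have := Dw (lshift m j); rewrite tnth_lshift Dl.
Qed.

End tuple_of_variables.

(** On a rectangle both sides equal the product of the [mu (B i)], whichever distinct indices are
    chosen. Hence every block of n observations has the law of the first n. *)
Lemma rvtuple_law d (Omega : measurableType d) (R : realType)
    (P : probability Omega R) d' (Omega' : measurableType d')
    (Q : probability Omega' R) d1 (T : measurableType d1)
    (I J : choiceType) (X : I -> {RV P >-> T}) (Y : J -> {RV Q >-> T})
    (mu : set T -> \bar R) (n : nat) (s : n.-tuple I) (t : n.-tuple J) :
  iid X mu -> iid Y mu -> uniq s -> uniq t ->
  forall A, measurable A ->
    P (rvtuple X s @^-1` A) = Q (rvtuple Y t @^-1` A).
Proof.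
move=> [indX lX] [indY lY] us ut.
apply: (law_ext (measurable_rects T n)).
- exact: rects_setI.
- exact: rects_setT.
move=> _ [B mB <-]; rewrite !mutually_independent_rect//.
apply: eq_bigr => i _.
have := lX (tnth s i) _ (mB i); have := lY (tnth t i) _ (mB i).
by rewrite /distribution /pushforward => -> ->.
Qed.

(* The statistics of finitely many disjoint blocks are gathered into one
   function of the concatenated block, so that independence of two blocks
   suffices. *)
Lemma block_sum_indep2 d (Omega : measurableType d) (R : realType)
    (P : probability Omega R) d1 (T : measurableType d1)
    (I : choiceType) (X : I -> {RV P >-> T}) (J : eqType) (n : nat)
    (S : J -> n.-tuple I) (g : n.-tuple T -> R) :
  mutually_independent X -> measurable_fun setT g ->
  (forall j, uniq (S j)) ->
  (forall j k i, i \in S j -> i \in S k -> j = k) ->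
  forall j js, uniq (j :: js) ->
  indep2 P (g \o rvtuple X (S j))
    (fun w => \sum_(k <- js) g (rvtuple X (S k) w)).
Proof.
move=> indX mg uS dS j js /= /andP[jjs ujs].
(* The clause that places each index of [s] in a block [S k] with [k] in [js] turns disjointness of
   the blocks into uniqueness of the concatenation, both here and in the induction. *)
suff [N [s [h [us sS mh hE]]]] : exists N (s : N.-tuple I)
    (h : N.-tuple T -> R), [/\ uniq s,
    forall i, i \in s -> exists2 k, k \in js & i \in S k,
    measurable_fun setT h &
    (fun w => \sum_(k <- js) g (rvtuple X (S k) w)) = h \o rvtuple X s].
  rewrite hE; apply: indep2_comp => //; apply: rvtuple_indep2 => //.
  rewrite cat_uniq uS us andbT /=; apply/hasPn => i /sS[k kjs iSk].
  by apply: contraL jjs => iSj; rewrite negbK (dS _ _ _ iSj iSk).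
elim: js ujs {j jjs} => [_|j js IH /= /andP[jjs ujs]].
  exists 0%N, [tuple], (fun=> 0); split => //.
  by apply/funext => w /=; rewrite big_nil.
have [N [s [h [us sS mh hE]]]] := IH ujs.
pose l (t : (n + N).-tuple T) : n.-tuple T := [tuple tnth t (lshift N i) | i < n].
pose r (t : (n + N).-tuple T) : N.-tuple T := [tuple tnth t (rshift n i) | i < N].
exists (n + N)%N, (cat_tuple (S j) s), (fun t => g (l t) + h (r t)); split.
- rewrite /= cat_uniq uS us andbT; apply/hasPn => i /sS[k kjs iSk].
  by apply: contraL jjs => iSj; rewrite negbK (dS _ _ _ iSj iSk).
- move=> i; rewrite /= mem_cat => /orP[iSj|/sS[k kjs iSk]].
    by exists j => //; rewrite mem_head.
  by exists k => //; rewrite inE kjs orbT.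
- apply: measurable_funD.
    apply: (measurableT_comp mg); apply/measurable_fun_tnthP => i.
    rewrite (_ : _ \o _ = @tnth _ T ^~ (lshift N i)); first exact: measurable_tnth.
    by apply/funext => t /=; rewrite tnth_mktuple.
  apply: (measurableT_comp mh); apply/measurable_fun_tnthP => i.
  rewrite (_ : _ \o _ = @tnth _ T ^~ (rshift n i)); first exact: measurable_tnth.
  by apply/funext => t /=; rewrite tnth_mktuple.
- apply/funext => w /=; rewrite big_cons; congr (_ + _).
    congr g; apply: eq_from_tnth => i.
    by rewrite !tnth_mktuple tnth_lshift.
  have /= -> := congr1 (@^~ w) hE; congr h; apply: eq_from_tnth => i.
  by rewrite !tnth_mktuple tnth_rshift.
Qed.

(** * Expectation of a product of independent variables *)

Section expectation_of_product.
Local Open Scope ereal_scope.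
Context d (Omega : measurableType d) (R : realType) (P : probability Omega R).

(** Independence is agreement on measurable rectangles, which characterizes the product measure. *)
Lemma indep2_pair_law (X Y : {RV P >-> R}) : indep2 P X Y ->
  forall A, measurable A -> A `<=` setT ->
  pushforward P (fun w => (X w, Y w)) A =
  (distribution P X \x distribution P Y) A.
Proof.
move=> XY A mA _.
have mXY : measurable_fun setT (fun w => (X w, Y w)).
  exact: measurable_fun_pair.
pose m : {measure set (R * R) -> \bar R} :=
  measure_function_pushforward__canonical__measure_function_Measure P mXY.
exact/esym/(@product_measure_unique _ _ _ _ _ _ _ m).
Qed.

Lemma indep2_ge0_integral (X Y : {RV P >-> R}) (f : R * R -> \bar R) :
  indep2 P X Y -> measurable_fun setT f -> (forall z, 0 <= f z) ->
  \int[P]_w f (X w, Y w) =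
  \int[distribution P X]_x \int[distribution P Y]_y f (x, y).
Proof.
move=> XY mf f0.
have mXY : measurable_fun setT (fun w => (X w, Y w)).
  exact: measurable_fun_pair.
rewrite -[RHS](fubini_tonelli1 f)//.
transitivity (\int[pushforward P (fun w => (X w, Y w))]_z f z).
  by rewrite (ge0_integral_pushforward mXY).
exact: (eq_measure_integral _ (indep2_pair_law XY)).
Qed.

(** Fubini asks for integrability under the product of the laws; the nonnegative case applied to the
    absolute value of [f] transfers it from [P]. *)
Lemma indep2_integral (X Y : {RV P >-> R}) (f : R * R -> \bar R) :
  indep2 P X Y -> measurable_fun setT f ->
  P.-integrable setT (fun w => f (X w, Y w)) ->
  \int[P]_w f (X w, Y w) =
  \int[distribution P X]_x \int[distribution P Y]_y f (x, y).
Proof.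
move=> XY mf intf.
have mXY : measurable_fun setT (fun w => (X w, Y w)).
  exact: measurable_fun_pair.
rewrite (integral12_prod_meas1 (f := f)); last first.
  apply/integrable12ltyP => //.
  rewrite -(indep2_ge0_integral (f := abse \o f))//.
  - by have /integrableP[] := intf.
  - exact: measurableT_comp.
  - by move=> z; exact: abse_ge0.
transitivity (\int[pushforward P (fun w => (X w, Y w))]_z f z).
  by rewrite (integral_pushforward mXY).
exact: (eq_measure_integral _ (indep2_pair_law XY)).
Qed.

(** By Tonelli, the expectation of |XY| is the product of those of |X| and |Y|, both finite. *)
Lemma indep2_integrableM (X Y : {RV P >-> R}) : indep2 P X Y ->
  P.-integrable setT (EFin \o X) -> P.-integrable setT (EFin \o Y) ->
  P.-integrable setT (EFin \o (X \* Y)%R).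
Proof.
move=> XY iX iY; apply/integrableP; split.
  apply/measurable_EFinP; apply: measurable_funM; exact: measurable_funPT.
have mabs : measurable_fun setT (fun y : R => (`|y|)%R%:E).
  by apply/measurable_EFinP; exact: normr_measurable.
rewrite (indep2_ge0_integral (f := fun z => `|(z.1 * z.2)%:E|) XY)//; last first.
  by apply: measurableT_comp => //; apply/measurable_EFinP; exact: measurable_funM.
under eq_integral => x _.
  under eq_integral => y _ do rewrite /= normrM EFinM.
  rewrite ge0_integralZl//.
  rewrite (ge0_integral_distribution Y (f := fun y => (`|y|)%R%:E))//.
  over.
rewrite ge0_integralZr//; last by apply: integral_ge0 => w _; rewrite lee_fin.
rewrite (ge0_integral_distribution X (f := fun y => (`|y|)%R%:E))//.
have /integrableP[_ iXoo] := iX; have /integrableP[_ iYoo] := iY.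
rewrite lte_mul_pinfty//; first by apply: integral_ge0 => w _; rewrite lee_fin.
rewrite ge0_fin_numE//; by apply: integral_ge0 => w _; rewrite lee_fin.
Qed.

Lemma distribution_integrable_id (X : {RV P >-> R}) :
  P.-integrable setT (EFin \o X) ->
  (distribution P X).-integrable setT (fun x => x%:E).
Proof.
move=> iX.
apply: (integrable_pushforward (@measurable_funPT _ _ _ _ X)) => //.
by apply/measurable_EFinP; exact: measurable_id.
Qed.

Lemma indep2_expectationM (X Y : {RV P >-> R}) : indep2 P X Y ->
  P.-integrable setT (EFin \o X) -> P.-integrable setT (EFin \o Y) ->
  'E_P[X \* Y] = 'E_P[X] * 'E_P[Y].
Proof.
move=> XY iX iY; rewrite unlock.
have mf : measurable_fun setT (fun z : R * R => (z.1 * z.2)%:E).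
  by apply/measurable_EFinP; exact: measurable_funM.
rewrite (indep2_integral XY mf); last exact: (indep2_integrableM XY iX iY).
have iEY : \int[P]_w (Y w)%:E \is a fin_num by exact: integrable_fin_num.
under eq_integral => x _.
  under eq_integral do rewrite EFinM.
  rewrite integralZl//; last exact: distribution_integrable_id.
  rewrite (integral_distribution (f := EFin))//.
  over.
rewrite /= -(fineK iEY) integralZr//; last exact: distribution_integrable_id.
by rewrite (integral_distribution (f := EFin)).
Qed.

End expectation_of_product.

(** * Uniform approximation of [f (y + z)] by sums of products *)

Lemma bounded_funP (T : Type) (R : realType) (f : T -> R) :
  bounded_fun f <-> exists M, forall x, `|f x| <= M.
Proof.
split=> [[M [_ fM]]|[M fM]].
  by exists (M + 1) => x; apply: (fM (M + 1)); rewrite ?ltrDl.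
by exists M; split; [exact: num_real|move=> r Mr x _; exact: le_trans (fM x) (ltW Mr)].
Qed.

(** Compactness of the segment, in its near-covering form with [h] tending to 0 from the right. Only
    [x] is confined to the segment, so [x'] may leave it. *)
Lemma heine_segment (R : realType) (f : R -> R) (A e : R) :
  continuous f -> 0 < e ->
  exists2 h, 0 < h &
    forall x x', `|x| <= A -> `|x - x'| < h -> `|f x - f x'| <= e.
Proof.
move=> cf e0.
have /compact_near_coveringP cov := @segment_compact R (- A) A.
have H : \forall h \near 0^'+, `[- A, A] `<=`
    (fun x => forall x', `|x - x'| < h -> `|f x - f x'| <= e).
  apply: cov => x _.
  have /cvgrPdist_lt /(_ (e / 2)) := cf x.
  rewrite divr_gt0// => /(_ isT) /nbhs_ballP[r /= r0 fr].
  exists (ball x (r / 2), [set h | h < r / 2]); first split => /=.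
  - by apply: nbhsx_ballx; rewrite divr_gt0.
  - by apply: nbhs_right_lt; rewrite divr_gt0.
  move=> [u h] /= [xu hr] v uv.
  have fxu : `|f x - f u| < e / 2.
    by apply: fr; apply: lt_trans xu _; rewrite ltr_pdivrMr// ltr_pMr// ltr1n.
  have fxv : `|f x - f v| < e / 2.
    apply: fr; rewrite /ball/= [r]splitr.
    by rewrite (le_lt_trans (ler_distD u _ _))// ltrD// (lt_trans uv).
  rewrite [e]splitr (le_trans (ler_distD (f x) _ _))//.
  by rewrite lerD// ltW// distrC.
have [k [hk k0]] := filter_ex (filterI H (nbhs_right_gt (0 : R))).
exists k => // x x' xA; apply: hk.
by rewrite /= in_itv/= -ler_norml.
Qed.

(** The clamp min(max(t, 0), 1), in a form whose continuity is that of the absolute value. *)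
Definition ramp (R : realType) (t : R) : R := (`|t| - `|t - 1| + 1) / 2.

Lemma ramp_itv (R : realType) (t : R) : 0 <= ramp t <= 1.
Proof. by rewrite /ramp; case: (ger0P t); case: (ger0P (t - 1)); lra. Qed.

Lemma ramp_le0 (R : realType) (t : R) : t <= 0 -> ramp t = 0.
Proof. by rewrite /ramp; case: (ger0P t); case: (ger0P (t - 1)); lra. Qed.

Lemma ramp_ge1 (R : realType) (t : R) : 1 <= t -> ramp t = 1.
Proof. by rewrite /ramp; case: (ger0P t); case: (ger0P (t - 1)); lra. Qed.

Lemma ler_ramp (R : realType) (s t : R) : s <= t -> ramp s <= ramp t.
Proof.
rewrite /ramp; case: (ger0P t); case: (ger0P (t - 1)); case: (ger0P s);
  case: (ger0P (s - 1)); lra.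
Qed.

Lemma continuous_ramp (R : realType) : continuous (@ramp R).
Proof.
move=> t; apply: cvgMl; apply: cvgD; last exact: cvg_cst.
apply: cvgB; first exact: cvg_norm.
by apply: cvg_norm; apply: cvgB => //; exact: cvg_cst.
Qed.

(* [phi i] is a partition of unity on a segment, obtained by telescoping
   translates of [ramp]; [chi] is its sum. *)
Lemma add_cutoff_approx (R : realType) (f : R -> R) (K e : R) :
  continuous f -> bounded_fun f -> 0 < e ->
  exists (N : nat) (chi : R -> R) (phi psi : nat -> R -> R),
  [/\ [/\ continuous chi, forall y, 0 <= chi y <= 1 &
          forall y, `|y| <= K -> chi y = 1],
      forall i, continuous (phi i) /\ bounded_fun (phi i),
      forall i, continuous (psi i) /\ bounded_fun (psi i) &
      forall y z,
        `|chi y * chi z * f (y + z) - \sum_(i < N) phi i y * psi i z| <= e].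
Proof.
move=> cf /bounded_funP[M fM] e0.
(* The margin 1 is at least the mesh [D] below, so [chi] has already climbed to 1 when [y] reaches
   -|K|. *)
pose L := `|K| + 1; have L0 : 0 < L by rewrite ltr_wpDl.
(* The modulus is used at the points [p i + z], where |p i| <= L and |z| <= L + 1. *)
have [h h0 hf] := heine_segment (2 * L + 2) cf e0.
(* The two summands ensure [D <= 1] and [2 * D < h] respectively. *)
pose N := (Num.truncn (2 * L + 4 * L / h)).+1.
have N0 : 0 < N%:R :> R by rewrite ltr0n.
have LN : 2 * L + 4 * L / h < N%:R by rewrite /N truncnS_gt.
pose D := 2 * L / N%:R.
have Lh : 0 < 4 * L / h by rewrite divr_gt0// mulr_gt0.
have D0 : 0 < D by rewrite divr_gt0// mulr_gt0.
have D1 : D <= 1 by rewrite ler_pdivrMr// mul1r; lra.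
have Dh : 2 * D < h.
  rewrite /D mulrA ltr_pdivrMr// [h * _]mulrC -ltr_pdivrMr//.
  by rewrite (le_lt_trans _ LN)//; lra.
have ND : D * N%:R = 2 * L by rewrite /D divfK// gt_eqF.
pose t y := (y + L) / D.
have ct : continuous t.
  by move=> y; apply: cvgMl; apply: cvgD => //; exact: cvg_cst.
have tD y : t y * D = y + L by rewrite /t divfK// gt_eqF.
(* In the rescaled variable [t y], which maps [-L, L] onto [0, N], [phi i] is a hat on [i, i + 2],
   and [chi] a trapezoid on [0, N + 1] equal to 1 on [1, N]. *)
pose phi i y := ramp (t y - i%:R) - ramp (t y - i.+1%:R).
pose chi y := ramp (t y) - ramp (t y - N%:R).
have cr a : continuous (fun y => ramp (t y - a)).
  move=> y; apply: (@continuous_comp _ _ _ (fun y => t y - a) (@ramp R)).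
    by apply: cvgB; [exact: ct|exact: cvg_cst].
  exact: continuous_ramp.
have cchi : continuous chi.
  move=> y; apply: cvgB; last exact: cr.
  by apply: (@continuous_comp _ _ _ t (@ramp R)); [exact: ct|exact: continuous_ramp].
have phi0 i y : 0 <= phi i y.
  by rewrite subr_ge0 ler_ramp// lerD2l lerN2 ler_nat.
have phi1 i y : phi i y <= 1.
  have /andP[_ +] := ramp_itv (t y - i%:R).
  by have /andP[+ _] := ramp_itv (t y - i.+1%:R); rewrite /phi; lra.
have sum_phi y : \sum_(i < N) phi i y = chi y.
  rewrite -(big_mkord xpredT (phi^~ y)).
  under eq_bigr => i _ do rewrite /phi -opprB.
  rewrite sumrN (telescope_sumr (fun i => ramp (t y - i%:R)))//.
  by rewrite subr0 opprB.
have chi01 y : 0 <= chi y <= 1.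
  apply/andP; split; first by rewrite -sum_phi sumr_ge0.
  have /andP[_ +] := ramp_itv (t y).
  by have /andP[+ _] := ramp_itv (t y - N%:R); rewrite /chi; lra.
have chiK y : `|y| <= K -> chi y = 1.
  move=> yK; have : `|y| <= `|K| by rewrite (le_trans yK)// ler_norm.
  rewrite ler_norml => /andP[y1 y2].
  rewrite /chi ramp_ge1 ?ramp_le0 ?subr0//.
    by rewrite subr_le0 -(ler_pM2r D0) tD mulrC ND /L; lra.
  by rewrite -(ler_pM2r D0) tD mul1r /L; lra.
have chi_supp y : chi y != 0 -> `|y| <= L + 1.
  rewrite leNgt; apply: contra; rewrite ltr_normr => /orP[] yL; apply/eqP.
    rewrite /chi !ramp_ge1 ?subrr//.
      by rewrite lerBrDr -(ler_pM2r D0) tD mulrDl mul1r (mulrC _ D) ND; lra.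
    by rewrite -(ler_pM2r D0) tD mul1r; lra.
  rewrite /chi !ramp_le0 ?subrr//.
    by rewrite subr_le0 -(ler_pM2r D0) tD mulrC ND; lra.
  by rewrite -(ler_pM2r D0) tD mul0r; lra.
(* The left end of the support of [phi i], an interval of length [2 * D]. *)
pose p i := i%:R * D - L.
have phi_supp i y : phi i y != 0 -> `|y - p i| <= 2 * D.
  rewrite leNgt; apply: contra; rewrite ltr_normr => /orP[] yp; apply/eqP.
    have : (i%:R + 2) * D < t y * D by rewrite tD; move: yp; rewrite /p; lra.
    rewrite ltr_pM2r// => ti.
    rewrite /phi !ramp_ge1 ?subrr//; last by lra.
    by rewrite -addn1 natrD; lra.
  have : t y * D < i%:R * D by rewrite tD; move: yp; rewrite /p; lra.
  rewrite ltr_pM2r// => ti.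
  rewrite /phi !ramp_le0 ?subrr//; last by lra.
  by rewrite -addn1 natrD; lra.
(* On the support of [phi i], [y] is frozen at [p i], which separates the variables. *)
exists N, chi, phi, (fun i z => chi z * f (p i + z)); split.
- by [].
- move=> i; split; first by move=> y; apply: cvgB; exact: cr.
  by apply/bounded_funP; exists 1 => y; rewrite ger0_norm.
- move=> i; split.
    move=> z; apply: cvgM; first exact: cchi.
    apply: (@continuous_comp _ _ _ (fun z => p i + z) f); last exact: cf.
    by apply: cvgD => //; exact: cvg_cst.
  apply/bounded_funP; exists M => z; rewrite normrM.
  have /andP[c0 c1] := chi01 z.
  by rewrite (ger0_norm c0) -[leRHS]mul1r ler_pM.
move=> y z; have /andP[cz0 cz1] := chi01 z; have /andP[cy0 cy1] := chi01 y.
(* The error becomes a combination of local errors with weights [phi i y], whose total [chi y] is at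
   most 1. *)
rewrite -{1}sum_phi !mulr_suml -sumrB.
apply: (le_trans (ler_norm_sum _ _ _)).
apply: (@le_trans _ _ (\sum_(i < N) phi i y * e)); last first.
  by rewrite -mulr_suml sum_phi ler_piMl// ltW.
apply: ler_sum => i _.
rewrite -!mulrA -mulrBr -mulrBr normrM (ger0_norm (phi0 i y)).
have [->|/phi_supp yp] := eqVneq (phi i y) 0; first by rewrite !mul0r.
rewrite ler_wpM2l// normrM (ger0_norm cz0).
have [->|/chi_supp zL] := eqVneq (chi z) 0; first by rewrite mul0r ltW.
rewrite -[leRHS]mul1r ler_pM// distrC hf//.
  rewrite (le_trans (ler_normD _ _))//.
  have pL : `|p i| <= L.
    rewrite ler_norml /p; have : i%:R * D <= 2 * L.
      by rewrite -ND mulrC ler_wpM2l ?ler_nat 1?ltnW// ltW.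
    have : 0 <= i%:R * D by rewrite mulr_ge0// ltW.
    lra.
  by move: zL pL; lra.
by rewrite (le_lt_trans _ Dh)// opprD addrACA subrr addr0 distrC.
Qed.

(** * Tightness, and expectations of bounded continuous functions *)

Definition mkRV d (Omega : measurableType d) (R : realType)
    (P : probability Omega R) (X : Omega -> R)
    (mX : measurable_fun setT X) : {RV P >-> R} :=
  HB.pack X (isMeasurableFun.Build _ _ _ _ _ mX).

Section bounded_continuous_functionals.
Context d (Omega : measurableType d) (R : realType) (P : probability Omega R).

Lemma bounded_integrable (X : Omega -> R) (M : R) :
  measurable_fun setT X -> (forall w, `|X w| <= M) ->
  P.-integrable setT (EFin \o X).
Proof.
move=> mX XM; apply: measurable_bounded_integrable => //.
  by rewrite (le_lt_trans (probability_le1 P measurableT))// ltry.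
by apply/bounded_funP; exists M.
Qed.

Lemma Rintegral_cst_probability (a : R) : \int[P]_w a = a.
Proof. by rewrite Rintegral_cst//= probability_setT mulr1. Qed.

Lemma comp_integrable (X : {RV P >-> R}) (f : R -> R) :
  continuous f -> bounded_fun f -> P.-integrable setT (EFin \o (f \o X)).
Proof.
move=> cf /bounded_funP[M fM]; apply: (@bounded_integrable _ M) => //=.
by apply: measurableT_comp => //; exact: continuous_measurable_fun.
Qed.

Lemma expectation_comp (X : {RV P >-> R}) (f : R -> R) :
  continuous f -> bounded_fun f ->
  ('E_P[f \o X])%E = (\int[P]_w f (X w))%:E.
Proof.
move=> cf bf; rewrite unlock /Rintegral fineK//.
exact: integrable_fin_num (comp_integrable X cf bf).
Qed.

Lemma measurable_norm_gt (X : {RV P >-> R}) (K : R) :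
  measurable [set w | K < `|X w|].
Proof.
rewrite (_ : [set _ | _] = (fun w => `|X w|) @^-1` `]K, +oo[); last first.
  by apply/seteqP; split=> w /=; rewrite in_itv/= andbT.
have mabs : measurable_fun setT (fun w => `|X w|).
  by apply: measurableT_comp => //; exact: normr_measurable.
by rewrite -[_ @^-1` _]setTI; exact: mabs.
Qed.

(** Continuity from above along the events |X| > n, whose intersection is empty. *)
Lemma tight (X : {RV P >-> R}) (e : R) : 0 < e ->
  exists K : R, (P [set w | (K < `|X w|)%R] <= e%:E)%E.
Proof.
move=> e0; pose F n := [set w | n%:R < `|X w|].
have mF n : measurable (F n) by exact: measurable_norm_gt.
have F0 : \bigcap_n F n = set0.
  rewrite -subset0 => w /(_ (Num.truncn `|X w|).+1 I) /=.
  by rewrite /F/= ltNge ltW// truncnS_gt.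
have : P (F n) @[n --> \oo] --> P (\bigcap_n F n).
  apply: nonincreasing_cvg_mu => //.
  - by rewrite (le_lt_trans (probability_le1 P (mF 0%N)))// ltry.
  - exact: bigcap_measurable.
  - move=> n k nk; apply/subsetPset => w; rewrite /F/=; apply: le_lt_trans.
    by rewrite ler_nat.
rewrite F0 measure0 => /fine_cvgP[_ /cvgrPdist_le /(_ _ e0)] [n _ /(_ n (leqnn n))].
rewrite /= sub0r normrN => nP; exists n%:R.
rewrite -(fineK (fin_num_measure P _ (mF n))) lee_fin.
exact: le_trans (ler_norm _) nP.
Qed.

(** The function 1 - chi is at most the indicator of |y| > K. *)
Lemma Rintegral_cutoff_le (X : {RV P >-> R}) (chi : R -> R) (K e : R) :
  continuous chi -> (forall y, 0 <= chi y <= 1) ->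
  (forall y, `|y| <= K -> chi y = 1) ->
  (P [set w | (K < `|X w|)%R] <= e%:E)%E ->
  1 - \int[P]_w chi (X w) <= e.
Proof.
move=> cchi chi01 chiK PK.
have bchi : bounded_fun chi.
  apply/bounded_funP; exists 1 => y; have /andP[c0 c1] := chi01 y.
  by rewrite ger0_norm.
have ichi := comp_integrable X cchi bchi.
pose A := [set w | K < `|X w|].
have mA : measurable A by exact: measurable_norm_gt.
have iA : P.-integrable setT (EFin \o (\1_A : Omega -> R)).
  apply: (@bounded_integrable _ 1) => // w.
  by rewrite ger0_norm indicE ?ler0n// lern1 leq_b1.
have -> : 1 - \int[P]_w chi (X w) = \int[P]_w (1 - chi (X w)).
  rewrite RintegralB// ?Rintegral_cst_probability//.
  by apply: (@bounded_integrable _ 1) => // w; rewrite normr1.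
apply: (@le_trans _ _ (\int[P]_w \1_A w)).
  apply: le_Rintegral => //.
    apply: (@bounded_integrable _ 1) => [|w /=].
      apply: measurable_funB => //.
      by apply: measurableT_comp => //; exact: continuous_measurable_fun.
    by have /andP[c0 c1] := chi01 (X w); rewrite ger0_norm; lra.
  move=> w _; have /andP[c0 c1] := chi01 (X w).
  have [XK|XK] := leP `|X w| K; first by rewrite chiK// subrr indicE ler0n.
  by rewrite indicE mem_set//=; lra.
rewrite /Rintegral integral_indic// setIT -lee_fin fineK//.
by rewrite fin_num_measure.
Qed.

Lemma indep2_Rintegral_comp (X Y : {RV P >-> R}) (f g : R -> R) :
  continuous f -> bounded_fun f -> continuous g -> bounded_fun g ->
  indep2 P X Y ->
  P.-integrable setT (EFin \o (fun w => f (X w) * g (Y w))) /\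
  \int[P]_w (f (X w) * g (Y w)) =
  \int[P]_w f (X w) * \int[P]_w g (Y w).
Proof.
move=> cf bf cg bg XY.
have mf := continuous_measurable_fun cf.
have mg := continuous_measurable_fun cg.
have mfX : measurable_fun setT (f \o X) by exact: measurableT_comp.
have mgY : measurable_fun setT (g \o Y) by exact: measurableT_comp.
have fXgY : indep2 P (mkRV P mfX) (mkRV P mgY) by exact: indep2_comp.
have ifX := comp_integrable X cf bf; have igY := comp_integrable Y cg bg.
split; first exact: indep2_integrableM fXgY ifX igY.
apply: EFin_inj; rewrite EFinM -!expectation_comp//.
have := indep2_expectationM fXgY ifX igY => /= <-.
rewrite unlock /Rintegral fineK//; apply: integrable_fin_num => //.
exact: indep2_integrableM fXgY ifX igY.
Qed.

(** The bound depends on the laws only through expectations of [chi], so it can be followed to the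
    limit along a sequence. *)
Lemma indep2_sum_approx (X Y : {RV P >-> R}) (f chi : R -> R) (M e : R)
    (N : nat) (phi psi : nat -> R -> R) :
  indep2 P X Y -> continuous f -> (forall x, `|f x| <= M) ->
  continuous chi -> (forall y, 0 <= chi y <= 1) ->
  (forall i, continuous (phi i) /\ bounded_fun (phi i)) ->
  (forall i, continuous (psi i) /\ bounded_fun (psi i)) ->
  (forall y z,
     `|chi y * chi z * f (y + z) - \sum_(i < N) phi i y * psi i z| <= e) ->
  `|\int[P]_w f (X w + Y w) -
    \sum_(i < N) \int[P]_w phi i (X w) * \int[P]_w psi i (Y w)| <=
  M * ((1 - \int[P]_w chi (X w)) + (1 - \int[P]_w chi (Y w))) + e.
Proof.
move=> XY cf fM cchi chi01 cphi cpsi approx.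
have M0 : 0 <= M by rewrite (le_trans _ (fM 0)).
have bchi : bounded_fun chi.
  apply/bounded_funP; exists 1 => y; have /andP[c0 c1] := chi01 y.
  by rewrite ger0_norm.
have cstI (a : R) : P.-integrable setT (EFin \o (fun=> a)).
  by apply: (@bounded_integrable _ `|a|).
pose S w := \sum_(i < N) phi i (X w) * psi i (Y w).
have [iS ES] : P.-integrable setT (EFin \o S) /\ \int[P]_w S w =
    \sum_(i < N) \int[P]_w phi i (X w) * \int[P]_w psi i (Y w).
  rewrite /S; elim: N {approx S} => [|N [IH1 IH2]].
    under [X in EFin \o X]eq_fun do rewrite big_ord0.
    under eq_Rintegral do rewrite big_ord0.
    by rewrite big_ord0 Rintegral_cst_probability.
  have [c1 b1] := cphi N; have [c2 b2] := cpsi N.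
  have [iN EN] := indep2_Rintegral_comp c1 b1 c2 b2 XY.
  under [X in EFin \o X]eq_fun do rewrite big_ord_recr/=.
  under eq_Rintegral do rewrite big_ord_recr/=.
  split; first exact: (integrableD _ IH1 iN).
  by rewrite RintegralD// big_ord_recr/= IH2 EN.
have iF : P.-integrable setT (EFin \o (fun w => f (X w + Y w))).
  apply: (@bounded_integrable _ M) => //.
  apply: measurableT_comp; first exact: continuous_measurable_fun.
  by apply: measurable_funD; exact: measurable_funPT.
have icX := comp_integrable X cchi bchi; have icY := comp_integrable Y cchi bchi.
pose B w := M * ((1 - chi (X w)) + (1 - chi (Y w))) + e.
have i1 : P.-integrable setT (EFin \o (fun w => 1 - chi (X w))).
  exact: (integrableB _ (cstI 1) icX).
have i2 : P.-integrable setT (EFin \o (fun w => 1 - chi (Y w))).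
  exact: (integrableB _ (cstI 1) icY).
have i12 : P.-integrable setT
    (EFin \o (fun w => (1 - chi (X w)) + (1 - chi (Y w)))).
  exact: (integrableD _ i1 i2).
have i3 : P.-integrable setT
    (EFin \o (fun w => M * ((1 - chi (X w)) + (1 - chi (Y w))))).
  exact: (integrableZl _ M i12).
have iB : P.-integrable setT (EFin \o B) by exact: (integrableD _ i3 (cstI e)).
have EB : \int[P]_w B w =
    M * ((1 - \int[P]_w chi (X w)) + (1 - \int[P]_w chi (Y w))) + e.
  rewrite /B RintegralD// RintegralZl// RintegralD// !RintegralB//.
  by rewrite !Rintegral_cst_probability.
have iFS : P.-integrable setT (EFin \o (fun w => f (X w + Y w) - S w)).
  exact: (integrableB _ iF iS).
rewrite -ES -EB -RintegralB//.
apply: (le_trans (le_normr_Rintegral _ iFS)) => //.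
apply: le_Rintegral => //; first exact: integrable_norm.
move=> w _; rewrite /B /S.
set F := f _; set s := \sum_(i < N) _.
have := approx (X w) (Y w); rewrite -/F -/s.
have /andP[x0 x1] := chi01 (X w); have /andP[y0 y1] := chi01 (Y w).
set x := chi (X w) in x0 x1 *; set y := chi (Y w) in y0 y1 * => xys.
(* The first term is the loss by cutoff, controlled by 1 - xy <= (1 - x) + (1 - y), that is, (1 -
   x)(1 - y) >= 0; the second is the error of approximation. *)
have -> : F - s = (1 - x * y) * F + (x * y * F - s) by lra.
rewrite (le_trans (ler_normD _ _))// lerD// normrM.
have xy1 : x * y <= 1 by rewrite mulr_ile1.
rewrite (ger0_norm (x := 1 - _)) ?subr_ge0// mulrC ler_pM ?subr_ge0//; first exact: fM.
nra.
Qed.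

End bounded_continuous_functionals.

(** * Convergence in distribution of a sum of two independent variables *)

Section convergence_in_distribution.
Context (R : realType) d (Omega : measurableType d) (P : probability Omega R)
  d' (Omega' : measurableType d') (Q : probability Omega' R).

Lemma cvg_in_distributionP (X : nat -> {RV P >-> R}) (Y : {RV Q >-> R}) :
  cvg_in_distribution P (fun n => X n : Omega -> R) Q Y <->
  (forall f : R -> R, continuous f -> bounded_fun f ->
    \int[P]_w f (X n w) @[n --> \oo] --> \int[Q]_w f (Y w)).
Proof.
split=> XY f cf bf; have := XY f cf bf.
  rewrite expectation_comp// => /fine_cvgP[_].
  by under eq_fun do rewrite /= expectation_comp//=.
move=> XYf; rewrite expectation_comp//.
under eq_fun do rewrite expectation_comp//.
by apply/fine_cvgP; split; [exact: nearW|exact: XYf].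
Qed.

Lemma cvg_in_distribution_comp (X : nat -> Omega -> R) (Y : Omega' -> R)
    (g : R -> R) : continuous g -> cvg_in_distribution P X Q Y ->
  cvg_in_distribution P (fun n => g \o X n) Q (g \o Y).
Proof.
move=> cg XY f cf /bounded_funP[M fM]; apply: (XY (f \o g)).
  by move=> x; apply: continuous_comp; [exact: cg|exact: cf].
by apply/bounded_funP; exists M => x /=.
Qed.

Lemma cvg_in_distributionD (X X' : nat -> {RV P >-> R}) (Y Y' : {RV Q >-> R}) :
  (forall n, indep2 P (X n) (X' n)) -> indep2 Q Y Y' ->
  cvg_in_distribution P (fun n => X n : Omega -> R) Q Y ->
  cvg_in_distribution P (fun n => X' n : Omega -> R) Q Y' ->
  cvg_in_distribution P (fun n w => X n w + X' n w) Q (fun w => Y w + Y' w).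
Proof.
move=> XX' YY' /cvg_in_distributionP XY /cvg_in_distributionP X'Y'.
pose S n := mkRV P (measurable_funD (@measurable_funPT _ _ _ _ (X n))
  (@measurable_funPT _ _ _ _ (X' n))).
pose T := mkRV Q (measurable_funD (@measurable_funPT _ _ _ _ Y)
  (@measurable_funPT _ _ _ _ Y')).
apply/(cvg_in_distributionP S T) => f cf bf.
have /bounded_funP[M fM] := bf.
have M0 : 0 <= M by rewrite (le_trans _ (fM 0)).
apply/cvgrPdist_lt => e e0.
(* The limiting error is [b' + b'] with [b' <= 2 * M * a + a], hence at most (4M + 2)a, strictly
   below e = (4M + 3)a. *)
pose a := e / (4 * M + 3); have a0 : 0 < a by rewrite divr_gt0//; lra.
have [K1 PK1] := tight Y a0; have [K2 PK2] := tight Y' a0.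
have [N [chi [phi [psi [[cchi chi01 chiK] cphi cpsi approx]]]]] :=
  add_cutoff_approx (Num.max K1 K2) cf bf a0.
have bchi : bounded_fun chi.
  apply/bounded_funP; exists 1 => y; have /andP[c0 c1] := chi01 y.
  by rewrite ger0_norm.
have chiY : 1 - \int[Q]_w chi (Y w) <= a.
  apply: Rintegral_cutoff_le PK1 => // y yK; apply: chiK.
  by rewrite le_max yK.
have chiY' : 1 - \int[Q]_w chi (Y' w) <= a.
  apply: Rintegral_cutoff_le PK2 => // y yK; apply: chiK.
  by rewrite le_max yK orbT.
pose c n := \sum_(i < N) \int[P]_w phi i (X n w) * \int[P]_w psi i (X' n w).
pose l := \sum_(i < N) \int[Q]_w phi i (Y w) * \int[Q]_w psi i (Y' w).
have cl : c n @[n --> \oo] --> l.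
  rewrite /c /l; elim: N {approx c l} => [|N IH].
    under eq_fun do rewrite big_ord0.
    by rewrite big_ord0; exact: cvg_cst.
  under eq_fun do rewrite big_ord_recr/=.
  rewrite big_ord_recr/=; apply: cvgD => //.
  have [c1 b1] := cphi N; have [c2 b2] := cpsi N.
  by apply: cvgM; [exact: XY|exact: X'Y'].
pose b n := M * ((1 - \int[P]_w chi (X n w)) + (1 - \int[P]_w chi (X' n w))) + a.
pose b' := M * ((1 - \int[Q]_w chi (Y w)) + (1 - \int[Q]_w chi (Y' w))) + a.
(* Here [chi] serves as a test function, so the error bound for [X n] and [X' n] tends to that of
   the limits. *)
have bb' : b n @[n --> \oo] --> b'.
  apply: cvgD; last exact: cvg_cst.
  apply: cvgM; first exact: cvg_cst.
  by apply: cvgD; apply: cvgB; [exact: cvg_cst|exact: XY|exact: cvg_cst|exact: X'Y'].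
have Db : b' + b n + `|l - c n| @[n --> \oo] --> b' + b' + `|l - l|.
  apply: cvgD; first by apply: cvgD => //; exact: cvg_cst.
  by apply: cvg_norm; apply: cvgB => //; exact: cvg_cst.
have b'e : b' + b' + `|l - l| < e.
  rewrite subrr normr0 addr0.
  have : b' <= M * (a + a) + a by rewrite lerD2r ler_wpM2l// lerD.
  have : a * (4 * M + 3) = e by rewrite /a divfK// gt_eqF//; lra.
  nra.
apply: filterS (cvgr_lt _ Db _ b'e) => n; apply: le_lt_trans.
have eY := indep2_sum_approx YY' cf fM cchi chi01 cphi cpsi approx.
have eX := indep2_sum_approx (XX' n) cf fM cchi chi01 cphi cpsi approx.
rewrite -/l -/b' in eY; rewrite -/(c n) -/(b n) in eX.
rewrite (le_trans (ler_distD l _ _))// -addrA lerD//.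
rewrite (le_trans (ler_distD (c n) _ _))// addrC lerD// distrC.
exact: eX.
Qed.

End convergence_in_distribution.

(** * Transfer of expectation and variance between variables of the same law *)

Section same_law.
Context (R : realType) d (Omega : measurableType d) (P : probability Omega R)
  d' (Omega' : measurableType d') (Q : probability Omega' R)
  (X : {RV P >-> R}) (Y : {RV Q >-> R})
  (XY : same_law (distribution P X) (distribution Q Y)).

(** The positive and negative parts of [h] are integrated separately, each against the common
    law. *)
Lemma same_law_integral (h : R -> \bar R) : measurable_fun setT h ->
  (\int[P]_w h (X w) = \int[Q]_w h (Y w))%E.
Proof.
have ge0 (k : R -> \bar R) : measurable_fun setT k -> (forall x, (0 <= k x)%E) ->
    (\int[P]_w k (X w) = \int[Q]_w k (Y w))%E.
  move=> mk k0; have := ge0_integral_distribution X mk k0 => /= <-.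
  have := ge0_integral_distribution Y mk k0 => /= <-.
  by apply: eq_measure_integral => A mA _; exact: XY.
move=> mh; change (integral P setT (h \o X) = integral Q setT (h \o Y)).
rewrite integralE [RHS]integralE (funepos_comp h X) (funepos_comp h Y)
  (funeneg_comp h X) (funeneg_comp h Y).
congr (_ - _)%E.
  by apply: (ge0 h^\+%E); [exact: measurable_funepos|exact: funepos_ge0].
by apply: (ge0 h^\-%E); [exact: measurable_funeneg|exact: funeneg_ge0].
Qed.

Lemma same_law_expectation (f : R -> R) : measurable_fun setT f ->
  ('E_P[f \o X] = 'E_Q[f \o Y])%E.
Proof.
move=> mf; rewrite unlock.
by apply: (same_law_integral (h := EFin \o f)); exact/measurable_EFinP.
Qed.

Lemma same_law_variance : ('V_P[X] = 'V_Q[Y])%E.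
Proof.
have EXY : ('E_P[X] = 'E_Q[Y])%E.
  have mid : measurable_fun setT (@id R) by exact: measurable_id.
  exact: (same_law_expectation mid).
rewrite /variance unlock EXY; set c := fine _.
apply: (same_law_expectation (f := fun x => (x - c) * (x - c))).
by apply: measurable_funM; apply: measurable_funB.
Qed.

End same_law.

(** For a centred variable the variance is the integral of the square. *)
Lemma variance_Lfun2 (R : realType) d (Omega : measurableType d)
    (P : probability Omega R) (X : {RV P >-> R}) :
  ('E_P[X] = 0)%E -> ('V_P[X] < +oo)%E -> (X : Omega -> R) \in Lfun P 2%:E.
Proof.
move=> EX; rewrite /variance unlock EX unlock => VX.
rewrite inE; apply/andP; split; rewrite !inE/=; first exact: measurable_funPT.
rewrite /finite_norm unlock /Lnorm poweR_lty//=.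
apply: le_lt_trans VX; rewrite le_eqVlt; apply/orP; left; apply/eqP.
apply: eq_integral => w _ /=.
by rewrite !fctE /cst /= !subr0 powR_mulrn// -normrX ger0_norm ?sqr_ge0// expr2.
Qed.

(** * Moments and limits of finite sums of independent variables *)

Section sums.
Context (J : eqType) (R : realType) d (Omega : measurableType d)
  (P : probability Omega R).

(** The part of mutual independence that an induction on the number of summands consumes. *)
Definition sum_indep (X : J -> {RV P >-> R}) : Prop :=
  forall j js, uniq (j :: js) ->
    indep2 P (X j) (fun w => \sum_(k <- js) X k w).

Lemma measurable_sumRV (X : J -> {RV P >-> R}) js :
  measurable_fun setT (fun w => \sum_(k <- js) X k w).
Proof.
elim: js => [|j js IH].
  by under eq_fun do rewrite big_nil; exact: measurable_cst.
under eq_fun do rewrite big_cons.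
by apply: measurable_funD => //; exact: measurable_funPT.
Qed.

(** Variances add because independence makes the covariance of head and tail vanish. Square
    integrability is carried along since additivity of mean and variance relies on it. *)
Lemma sum_indep_moments (X : J -> {RV P >-> R}) (v : R) : sum_indep X ->
  (forall j, (X j : Omega -> R) \in Lfun P 2%:E) ->
  (forall j, ('E_P[X j] = 0)%E) -> (forall j, ('V_P[X j] = v%:E)%E) ->
  forall js, uniq js ->
  [/\ (fun w => \sum_(k <- js) X k w) \in Lfun P 2%:E,
      ('E_P[fun w => (\sum_(k <- js) X k w)%R] = 0)%E &
      ('V_P[fun w => (\sum_(k <- js) X k w)%R] = ((size js)%:R * v)%:E)%E].
Proof.
move=> indX X2 EX VX.
have Pfin : P setT \is a fin_num := fin_num_measure P _ measurableT.
elim=> [_|j js IH ujs].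
  rewrite (_ : (fun w => _) = cst 0); last first.
    by apply/funext => w; rewrite big_nil.
  by split; [exact: Lfun_cst|exact: expectation_cst|rewrite variance_cst mul0r].
have /andP[jjs /IH[S2 ES VS]] := ujs.
rewrite (_ : (fun w => _) = X j \+ (fun w => \sum_(k <- js) X k w)); last first.
  by apply/funext => w; rewrite big_cons.
have X1 := Lfun_subset12 Pfin (X2 j); have S1 := Lfun_subset12 Pfin S2.
have XS1 := Lfun2_mul_Lfun1 (X2 j) S2.
have cov0 : covariance P (X j) (fun w => \sum_(k <- js) X k w) = 0%E.
  rewrite covarianceE// EX ES mule0 sube0.
  have /= -> := indep2_expectationM
    (X := X j) (Y := mkRV P (measurable_sumRV X js)) (indX _ _ ujs)
    ((Lfun1_integrable _ _).1 X1) ((Lfun1_integrable _ _).1 S1).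
  by rewrite EX mul0e.
split.
- by rewrite rpredD ?lee1n.
- by rewrite expectationD// EX ES adde0.
- by rewrite varianceD// VX VS cov0 mule0 adde0 -EFinD -natr1 mulrDl mul1r addrC.
Qed.

End sums.

Lemma cvg_in_distribution_sum (J : eqType) (R : realType)
    d (Omega : measurableType d) (P : probability Omega R)
    d' (Omega' : measurableType d') (Q : probability Omega' R)
    (X : nat -> J -> {RV P >-> R}) (Y : J -> {RV Q >-> R}) :
  (forall n, sum_indep (X n)) -> sum_indep Y ->
  (forall j, cvg_in_distribution P (fun n => X n j : Omega -> R) Q (Y j)) ->
  forall js, uniq js ->
  cvg_in_distribution P (fun n w => \sum_(k <- js) X n k w)
    Q (fun w => \sum_(k <- js) Y k w).
Proof.
move=> indX indY XY; elim=> [_ f cf bf|j js IH ujs].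
  under eq_fun => n.
    rewrite (_ : f \o _ = cst (f 0)); last first.
      by apply/funext => w /=; rewrite big_nil.
    rewrite expectation_cst; over.
  rewrite (_ : f \o _ = cst (f 0)); last first.
    by apply/funext => w /=; rewrite big_nil.
  by rewrite expectation_cst; exact: cvg_cst.
have /andP[_ ujs'] := ujs.
rewrite (_ : (fun n w => \sum_(k <- j :: js) X n k w) =
    (fun n w => X n j w + \sum_(k <- js) X n k w)); last first.
  by apply/funext => n; apply/funext => w; rewrite big_cons.
rewrite (_ : (fun w => \sum_(k <- j :: js) Y k w) =
    (fun w => Y j w + \sum_(k <- js) Y k w)); last first.
  by apply/funext => w; rewrite big_cons.
exact: (cvg_in_distributionD
  (X := fun n => X n j) (X' := fun n => mkRV P (measurable_sumRV (X n) js))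
  (Y' := mkRV Q (measurable_sumRV Y js))
  (fun n => indX n _ _ ujs) (indY _ _ ujs) (XY j) (IH ujs')).
Qed.

(** * The pooled estimator *)

Theorem lemma2p1 (R : realType)
  (* the data W_1, W_2, ... i.i.d. with law P *)
  (d : measure_display) (Omega : measurableType d) (Pr : probability Omega R)
  (dT : measure_display) (T : measurableType dT) (P : probability T R)
  (W : nat -> {RV Pr >-> T}) (W_iid : iid W P)
  (* parameter, estimators and rates *)
  (theta0 : probability T R -> R)
  (est : forall N : nat, {mfun N.-tuple T >-> R})
  (r : nat -> R) (r_gt0 : forall N : nat, (0 < N)%N -> 0 < r N)
  (r_o : r =o_\oo (fun N : nat => Num.sqrt (N%:R : R)))
  (* the limit G *)
  (dG : measure_display) (OmegaG : measurableType dG)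
  (PG : probability OmegaG R) (G : {RV PG >-> R})
  (G_non_normal : non_normal G)
  (sigma : R) (sigma2_gt0 : 0 < sigma ^+ 2)
  (G_mean : ('E_PG[G])%E = 0%:E) (G_var : ('V_PG[G])%E = (sigma ^+ 2)%:E)
  (est_cvg : cvg_in_distribution Pr
     (fun N w => r N * (full_estimator W est N w - theta0 P)) PG G)
  (* the division of the sample of size m * n *)
  (m : nat) (m_ge1 : (1 <= m)%N)
  (S : forall n : nat, 'I_m -> n.-tuple 'I_(m * n))
  (S_split : forall n : nat, equal_split (S n))
  (* i.i.d. copies G_1, ..., G_m of G *)
  (dH : measure_display) (OmegaH : measurableType dH)
  (PH : probability OmegaH R) (Gs : 'I_m -> {RV PH >-> R})
  (Gs_iid : iid Gs (distribution PG G)) :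
  let H : OmegaH -> R := fun w => (Num.sqrt m%:R)^-1 * \sum_(j < m) Gs j w in
  [/\ cvg_in_distribution Pr
        (fun n w => Num.sqrt m%:R * r n *
                    (pooled_estimator W est (S n) w - theta0 P)) PH H,
      ('E_PH[H])%E = 0%:E
    & ('V_PH[H])%E = (sigma ^+ 2)%:E].
Proof.
move=> H.
have m_gt0 : 0 < m%:R :> R by rewrite ltr0n.
have sm0 : 0 < Num.sqrt m%:R :> R by rewrite sqrtr_gt0.
have sm2 : Num.sqrt m%:R ^+ 2 = m%:R :> R by rewrite sqr_sqrtr// ltW.
have Gs_law j : same_law (distribution PH (Gs j)) (distribution PG G).
  exact: (Gs_iid.2 j).
have Gs_indep : sum_indep Gs.
  move=> j js ujs.
  (* Each [Gs k] is viewed as a statistic of a block of length one, so that the lemma on disjoint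
     blocks applies. *)
  pose g (t : 1.-tuple R) := tnth t ord0.
  have gE k : Gs k = g \o rvtuple Gs [tuple k] :> (_ -> _).
    by apply/funext => w /=; rewrite /g tnth_mktuple.
  rewrite gE (_ : (fun w => \sum_(k <- js) Gs k w) =
      (fun w => \sum_(k <- js) g (rvtuple Gs [tuple k] w))); last first.
    by apply/funext => w; apply: eq_bigr => k _; rewrite /g tnth_mktuple.
  apply: (block_sum_indep2 (S := fun k : 'I_m => [tuple k]) Gs_iid.1) => //.
    exact: measurable_tnth.
  by move=> k l i; rewrite !inE => /eqP -> /eqP.
pose s n j : n.-tuple nat := map_tuple val (S n j).
pose scaled n (t : n.-tuple T) := r n * (est n t - theta0 P).
have m_scaled n : measurable_fun setT (@scaled n).
  apply: measurable_funM => //; apply: measurable_funB => //.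
have us n j : uniq (s n j).
  by rewrite map_inj_uniq ?(S_split n).1//; exact: val_inj.
have ds n j k i : i \in s n j -> i \in s n k -> j = k.
  move=> /mapP[u uj ->] /mapP[v vk /val_inj uv].
  by apply: ((S_split n).2 j k u) => //; rewrite uv.
have mZ n j : measurable_fun setT (@scaled n \o rvtuple W (s n j)).
  exact: measurableT_comp (m_scaled n) (measurable_rvtuple W _).
pose Z n j := mkRV Pr (mZ n j).
have Z_indep n : sum_indep (Z n).
  move=> j js ujs.
  exact: (block_sum_indep2 W_iid.1 (m_scaled n) (us n) (ds n) ujs).
have Z_cvg j : cvg_in_distribution Pr (fun n => Z n j : Omega -> R) PH (Gs j).
  move=> f cf bf; have mf := continuous_measurable_fun cf.
  rewrite (same_law_expectation (Gs_law j) mf).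
  have := est_cvg f cf bf.
  (* The indices 0, ..., n - 1 read by [full_estimator] at sample size n; the block [s n j] has the
     same law, so [est_cvg] transfers to each [Z n j]. *)
  pose t n : n.-tuple nat := [tuple val i | i < n].
  have ut n : uniq (t n).
    by rewrite map_inj_uniq ?enum_uniq//; exact: val_inj.
  have mY n : measurable_fun setT (@scaled n \o rvtuple W (t n)).
    exact: measurableT_comp (m_scaled n) (measurable_rvtuple W _).
  rewrite (_ : (fun n => _) = (fun n => 'E_Pr[f \o Z n j])%E)//.
  apply/funext => n.
  have ZY : same_law (distribution Pr (Z n j)) (distribution Pr (mkRV Pr (mY n))).
    move=> A mA.
    apply: (rvtuple_law W_iid W_iid (us n j) (ut n) (A := @scaled n @^-1` A)).
    by rewrite -[_ @^-1` _]setTI; exact: m_scaled.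
  rewrite (same_law_expectation ZY mf); congr expectation.
  apply/funext => w /=; congr (f (r n * (est n _ - _))).
  by apply: eq_from_tnth => i; rewrite !tnth_mktuple.
have Gs_mean j : ('E_PH[Gs j] = 0)%E.
  have mid : measurable_fun setT (@id R) by exact: measurable_id.
  exact: etrans (same_law_expectation (Gs_law j) mid) G_mean.
have Gs_var j : ('V_PH[Gs j] = (sigma ^+ 2)%:E)%E.
  by rewrite -G_var; exact: same_law_variance.
have Gs_L2 j : (Gs j : OmegaH -> R) \in Lfun PH 2%:E.
  by apply: variance_Lfun2 => //; rewrite Gs_var ltry.
have [sum_L2 sum_mean sum_var] :=
  sum_indep_moments Gs_indep Gs_L2 Gs_mean Gs_var (index_enum_uniq 'I_m).
have HE : H = (Num.sqrt m%:R)^-1 \o* (fun w => \sum_(j < m) Gs j w).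
  by apply/funext => w; rewrite /H /= mulrC.
split.
- rewrite (_ : (fun n w => _) = (fun n => (fun x => (Num.sqrt m%:R)^-1 * x) \o
    (fun w => \sum_(j < m) Z n j w))); last first.
    apply/funext => n; apply/funext => w /=.
    rewrite -mulr_sumr sumrB sumr_const card_ord /pooled_estimator.
    rewrite (_ : \sum_(j < m) sub_estimator W est (S n j) w =
                 \sum_(j < m) est n (rvtuple W (s n j) w)); last first.
      apply: eq_bigr => j _; congr (est n _).
      by apply: eq_from_tnth => i; rewrite !tnth_mktuple tnth_map.
    rewrite -[theta0 P *+ m]mulr_natr; move: (\sum_(j < m) _) => u.
    (* With m written as q^2, the claim is the rational identity q r (u / q^2 - theta) = q^-1 r (u -
       q^2 theta). *)
    move: sm2 (lt0r_neq0 sm0); move: (Num.sqrt m%:R) => q <- q0.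
    by field.
  apply: (cvg_in_distribution_comp
    (Y := fun w => \sum_(j < m) Gs j w) (g := *%R (Num.sqrt m%:R)^-1)).
    by move=> x; apply: cvgMr; exact: cvg_id.
  apply: cvg_in_distribution_sum => //; exact: index_enum_uniq.
- rewrite HE expectationZl ?sum_mean ?mule0//.
  by apply: (Lfun_subset12 _ sum_L2); exact: fin_num_measure.
- rewrite HE varianceZ// sum_var [index_enum _]unlock -enumT size_enum_ord.
  by rewrite -EFinM mulrA exprVn sm2 mulVf ?mul1r// gt_eqF.
Qed.
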